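(* Let $\alpha>0$, let $0\le f\in L^1[-\pi,\pi]$ and let $u_f$ be the solution of the Robin problem with heat source $f$. Let $b\in(-\pi,0)\cup(0,\pi)$, let $f_H$ be the polarization of $f$ with respect to $b$, and let $u_{f_H}$ be the solution of the Robin problem (with the same $\alpha$) with heat source $f_H$. Then $$\int_{-\pi}^{\pi}\phi\bigl(u_f(x)\bigr)\,dx\le\int_{-\pi}^{\pi}\phi\bigl(u_{f_H}(x)\bigr)\,dx$$ for every convex and increasing function $\phi:\mathbb{R}\to\mathbb{R}$. Furthermore, if $\phi$ is (convex and) strictly increasing, then equality holds in this inequality if and only if $f=f_H$ a.e. on $[-\pi,\pi]$.
   Context: Robin problem: for $\alpha>0$ and $f\in L^1[-\pi,\pi]$, $u_f$ denotes the unique function $u\in C^1[-\pi,\pi]$ such that $u'$ is absolutely continuous on $[-\pi,\pi]$, $-u''=f$ a.e. on $(-\pi,\pi)$, and $-u'(-\pi)+\alpha u(-\pi)=u'(\pi)+\alpha u(\pi)=0$. (Equivalently, $u_f(x)=\int_{-\pi}^{\pi}G(x,y)f(y)\,dy$ with $G(x,y)=-\frac12 c_\alpha xy-\frac12|x-y|+\frac{1}{2c_\alpha}$, $c_\alpha=\frac{\alpha}{1+\alpha\pi}$.) Polarization (towards zero) of $f$ with respect to $b$, where $H$ is the open half-line of $\mathbb{R}\setminus\{b\}$ containing $0$: if $b\in(0,\pi)$, then $f_H(x)=f(x)$ for $x\in[-\pi,2b-\pi)$, $f_H(x)=\max\{f(x),f(2b-x)\}$ for $x\in[2b-\pi,b]$,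 and $f_H(x)=\min\{f(x),f(2b-x)\}$ for $x\in[b,\pi]$. If $b\in(-\pi,0)$, then $f_H(x)=\min\{f(x),f(2b-x)\}$ for $x\in[-\pi,b]$, $f_H(x)=\max\{f(x),f(2b-x)\}$ for $x\in[b,2b+\pi]$, and $f_H(x)=f(x)$ for $x\in(2b+\pi,\pi]$. ''Increasing'' means non-decreasing. *)

(* Defs.v *)
From HB Require Import structures.
From mathcomp Require Import all_boot all_order all_algebra.
From mathcomp Require Import all_classical all_reals all_analysis.

Set Implicit Arguments.
Unset Strict Implicit.
Unset Printing Implicit Defensive.

Import Order.TTheory GRing.Theory Num.Theory.
Import numFieldNormedType.Exports.

Local Open Scope classical_set_scope.
Local Open Scope ring_scope.

Definition absolutely_continuous_on (R : realType) (lo hi : R) (g : R -> R) :=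
  forall e : R, 0 < e -> exists2 d : R, 0 < d &
    forall (n : nat) (a b : 'I_n -> R),
      (forall i, [/\ lo <= a i, a i <= b i & b i <= hi]) ->
      trivIset setT (fun i => `]a i, b i[%classic) ->
      \sum_(i < n) (b i - a i) < d ->
      \sum_(i < n) `|g (b i) - g (a i)| < e.

(* On a closed interval A this is the usual derivative at interior points and
   the one-sided derivative at the endpoints. *)
Definition has_derivative_within (R : realType) (A : set R) (g : R -> R)
    (x l : R) :=
  (g y - g x) / (y - x) @[y --> within A x^'] --> l.

(* Only the values of f and u on [-pi, pi] matter; du is u'. *)
Definition robin_solution (R : realType) (alpha : R) (f u : R -> R) :=
  exists du : R -> R,
    [/\ [/\ forall x, x \in `[- pi, pi] ->
               has_derivative_within `[- pi, pi] u x (du x),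
            {within `[- pi, pi], continuous du} &
            absolutely_continuous_on (- pi) pi du],
        \forall x \ae (@lebesgue_measure R), x \in `]- pi, pi[ ->
          is_derive x 1 du (- f x),
        - du (- pi) + alpha * u (- pi) = 0 &
        du pi + alpha * u pi = 0].

(* Meaningful for b in ]-pi, 0[ or ]0, pi[ and x in [-pi, pi]; the two clauses
   that overlap at x = b agree there. *)
Definition polarization (R : realType) (b : R) (f : R -> R) (x : R) : R :=
  if 0 < b then
    if x < 2 * b - pi then f x
    else if x <= b then Num.max (f x) (f (2 * b - x))
    else Num.min (f x) (f (2 * b - x))
  else
    if x <= b then Num.min (f x) (f (2 * b - x))
    else if x <= 2 * b + pi then Num.max (f x) (f (2 * b - x))
    else f x.

(* Main.v *)
Require Import Defs.
From HB Require Import structures.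
From mathcomp Require Import all_boot all_order all_algebra.
From mathcomp Require Import all_classical all_reals all_analysis.
From mathcomp Require Import measurable_realfun ring lra.

(* Let b > 0 (the case b < 0 follows by reflecting at 0), w = v - u, sigma x = 2b - x
   and a = 2b - pi. The source h = f_H - f of w vanishes on [-pi, a], is nonnegative on [-pi, b] and
   antisymmetric under sigma. Hence w is affine on [-pi, a] and w + w o sigma is constant on
   [a, b]; with the Robin conditions everything is expressed through m = w(-pi), which
   concavity of w on [-pi, b] forces to be nonnegative: w(b) = alpha b m, and w >= 0 on
   [-pi, b]. The function v - u o sigma is concave on [a, b] because the polarization
   dominates f o sigma there, and its end values are nonnegative. So on [a, b] the pair
   (v x, v (sigma x)) weakly majorizes (u x, u (sigma x)), and u <= v on [-pi, a]; folding the
   integral at b gives the inequality. Equality forces m = 0, since u < v on [-pi, a]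
   otherwise, and m = 0 holds exactly when w = 0, i.e. when h = 0 almost everywhere. *)

Set Implicit Arguments.
Unset Strict Implicit.
Unset Printing Implicit Defensive.

Import Order.TTheory GRing.Theory Num.Theory.
Import numFieldNormedType.Exports.

Local Open Scope classical_set_scope.
Local Open Scope ring_scope.

(** * Monotonicity of absolutely continuous functions *)

(** The supremum of the points reachable from [lo] is reachable by the local hypothesis on its left,
    and it cannot lie below [hi] by the same hypothesis on its right. This is compactness of the
    interval in a form suited to additive estimates. *)
Lemma cousin_induction (R : realType) (lo hi : R) (P : R -> R -> Prop) :
  lo <= hi ->
  (forall x y z, x <= y -> y <= z -> P x y -> P y z -> P x z) ->
  (forall x, lo <= x <= hi -> exists2 d : R, 0 < d &
     forall y, lo <= y <= hi -> `|y - x| < d ->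
       (y <= x -> P y x) /\ (x <= y -> P x y)) ->
  P lo hi.
Proof.
move=> lohi Ptrans Ploc.
pose S := [set x | lo <= x <= hi /\ P lo x].
have Slo : S lo.
  split; first by rewrite lexx.
  have [|d d0 /(_ lo)] := Ploc lo; first by rewrite lexx.
  by rewrite subrr normr0 lexx => /(_ lohi d0)[/(_ isT)].
have Sub : has_ubound S by exists hi => x [/andP[]].
have hS : has_sup S by split => //; exists lo.
set x0 := sup S.
have lox0 : lo <= x0 by exact: ub_le_sup.
have x0hi : x0 <= hi.
  by apply: ge_sup; [exists lo|move=> x [/andP[]]].
have x0I : lo <= x0 <= hi by rewrite lox0.
have [d d0 Pd] := Ploc _ x0I.
have Px0 : P lo x0.
  have [s [/andP[los shi] Ps] x0s] := sup_adherent d0 hS.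
  have sx0 : s <= x0 by apply: ub_le_sup => //; split => //; rewrite los.
  apply: (Ptrans _ s) => //.
  have [||+ _] := Pd s; [by rewrite los| |exact].
  by rewrite distrC ger0_norm ?subr_ge0// ltrBlDr -ltrBlDl addrC -/x0 in x0s *; lra.
have [<-//|] := eqVneq x0 hi => x0neq.
have x0lt : x0 < hi by rewrite lt_neqAle x0neq.
pose y := Num.min hi (x0 + d / 2).
have x0y : x0 < y by rewrite lt_min x0lt ltrDl divr_gt0.
have yhi : y <= hi by rewrite ge_min lexx.
have yd : y <= x0 + d / 2 by rewrite ge_min lexx orbT.
have loy : lo <= y by lra.
have [||_ /(_ (ltW x0y)) Py] := Pd y; first by rewrite loy.
  by rewrite ger0_norm; lra.
have : y <= x0.
  apply: ub_le_sup => //; split; first by rewrite loy.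
  by apply: Ptrans Py => //; exact: ltW.
by rewrite leNgt x0y.
Qed.

(** Gaps between consecutive intervals are allowed, because stretches governed by a derivative
    estimate contribute no interval. The ordering makes the open intervals disjoint. *)
Fixpoint chain (R : realType) (s t : R) (l : seq (R * R)) : Prop :=
  if l is p :: l' then [/\ s <= p.1, p.1 <= p.2 & chain p.2 t l'] else s <= t.

Lemma chain_cat (R : realType) (s m t : R) (l1 l2 : seq (R * R)) :
  chain s m l1 -> chain m t l2 -> chain s t (l1 ++ l2).
Proof.
elim: l1 s => [|p l1 IH] s /=; last by move=> [? ? ?] ?; split => //; exact: IH.
by case: l2 => [|q l2] /=; [exact: le_trans|move=> sm [mq ? ?]; split => //; exact: le_trans mq].
Qed.

Lemma chain_le (R : realType) (s t : R) (l : seq (R * R)) : chain s t l -> s <= t.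
Proof.
elim: l s => [//|p l IH] s /= [sp pp /IH]; move: sp pp; lra.
Qed.

Lemma chain_nth (R : realType) (s t : R) (l : seq (R * R)) (i : nat) :
  chain s t l -> (i < size l)%N ->
  [/\ s <= (nth (0, 0) l i).1, (nth (0, 0) l i).1 <= (nth (0, 0) l i).2 &
      (nth (0, 0) l i).2 <= t].
Proof.
elim: l s i => [//|p l IH] s [|i] /= [sp pp c] il.
  by split => //; exact: chain_le c.
by have [? ? ?] := IH _ i c il; split => //; lra.
Qed.

Lemma chain_nth_le (R : realType) (s t : R) (l : seq (R * R)) (i j : nat) :
  chain s t l -> (i < j)%N -> (j < size l)%N ->
  (nth (0, 0) l i).2 <= (nth (0, 0) l j).1.
Proof.
elim: l s i j => [//|p l IH] s [|i] [|j]//= [sp pp c] ij jl.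
  by have [] := chain_nth c jl.
exact: IH c _ _.
Qed.

(** Induction on the list splits off the first interval. The half-open [[s, t[] keeps the remainder,
    inside [[b, t[], disjoint from []a, b[]. *)
Lemma chain_measure (R : realType) (U : set R) (s t : R) (l : seq (R * R)) :
  open U -> chain s t l -> (forall p, p \in l -> `]p.1, p.2[ `<=` U) ->
  ((\sum_(p <- l) (p.2 - p.1))%:E <=
   @lebesgue_measure R (U `&` `[s, t[%classic))%E.
Proof.
move=> oU; elim: l s => [|[a b] l IH] s /=.
  by rewrite big_nil.
move=> [sa ab c] lU; rewrite big_cons EFinD/=.
have bt := chain_le c.
have -> : ((b - a)%:E = @lebesgue_measure R `]a, b[%classic)%E.
  rewrite lebesgue_measure_itv/= lte_fin.
  by case: ltP => // ba; congr EFin; lra.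
apply: (@le_trans _ _ (@lebesgue_measure R (`]a, b[ `|` (U `&` `[b, t[)))%E).
  rewrite measureU//.
  - rewrite leeD2l//; apply: IH => // p pl; apply: lU.
    by rewrite inE pl orbT.
  - by apply: measurableI => //; exact: open_measurable.
  - rewrite -subset0 => x [] /=; rewrite !in_itv/= => /andP[_ xb] [_ /andP[bx _]].
    by move: xb; rewrite ltNge bx.
apply: le_measure.
- by rewrite inE; apply: measurableU => //; apply: measurableI => //; exact: open_measurable.
- by rewrite inE; apply: measurableI => //; exact: open_measurable.
- move=> x [xab|[Ux]] /=.
    split; first by apply: (lU (a, b)) => //; rewrite mem_head.
    by move: xab; rewrite /= !in_itv/= => /andP[? ?]; lra.
  by rewrite !in_itv/= => /andP[? ?]; split => //; lra.
Qed.

Lemma is_derive_near (R : realType) (g : R -> R) (x l e : R) :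
  is_derive x 1 g l -> 0 < e ->
  exists2 d : R, 0 < d & forall y, `|y - x| < d ->
    `|g y - g x - l * (y - x)| <= e * `|y - x|.
Proof.
move=> [/[swap] <- dg] e0.
have : h^-1 *: (g (h + x) - g x) @[h --> 0^'] --> 'D_1 g x.
  rewrite (_ : (fun h => _) = fun h => h^-1 *: ((g \o shift x) (h *: (1 : R)) - g x))//.
  by apply/funext => h /=; rewrite /GRing.scale/= mulr1.
move=> /cvgrPdist_le/(_ _ e0)[d/= d0 Hd]; exists d => // y yx.
have [->|yneq] := eqVneq y x; first by rewrite !subrr mulr0 subr0 !normr0 mulr0.
have yx0 : y - x != 0 by rewrite subr_eq0.
have := Hd (y - x); rewrite /ball_/= sub0r normrN => /(_ yx yx0).
rewrite subrK -(@ler_pM2r _ `|y - x|) ?normr_gt0// -normrM; congr (_ <= _).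
rewrite -normrN; congr `|_|; rewrite /GRing.scale/=; field.
by rewrite -mulN1r; lra.
Qed.

Lemma absolutely_continuous_on_sub (R : realType) (lo hi lo' hi' : R) (g : R -> R) :
  lo <= lo' -> hi' <= hi ->
  absolutely_continuous_on lo hi g -> absolutely_continuous_on lo' hi' g.
Proof.
move=> lolo hihi ac e e0; have [d d0 H] := ac e e0; exists d => // n a b ab.
by apply: H => i; have [? ? ?] := ab i; split => //; lra.
Qed.

(* The exceptional null set is covered by an open set U of measure less than the
   delta of absolute continuity. Points outside U contribute eps (t - s) to the increment of g, and
   points of U contribute intervals lying in U, on which g varies by at most eps. *)
Lemma absolutely_continuous_derive_le0 (R : realType) (lo hi : R) (g : R -> R) :
  lo <= hi -> absolutely_continuous_on lo hi g ->
  (\forall x \ae (@lebesgue_measure R), x \in `]lo, hi[ ->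
     exists2 l, l <= 0 & is_derive x 1 g l) ->
  g hi <= g lo.
Proof.
move=> lohi ac [N [mN N0 HN]].
rewrite -subr_le0; apply/ler_addgt0Pl => e e0; rewrite addr0.
(* Chosen so that [e1 * (hi - lo) <= e / 2]; the added 1 covers [lo = hi]. *)
pose e1 := e / 2 / (hi - lo + 1).
have e10 : 0 < e1 by rewrite !divr_gt0//; lra.
have [d d0 Hd] := ac (e / 2) (divr_gt0 e0 (ltr0Sn _ _)).
(* The endpoints join the exceptional set, since the derivative is only controlled on the open
   interval. *)
pose M := N `|` [set lo] `|` [set hi].
have mM : measurable M by apply: measurableU => //; exact: measurableU.
have M0 : @lebesgue_measure R M = 0%E.
  by rewrite !measureU0//; first [exact: lebesgue_measure_set1|exact: measurableU].
have [U [oU MU Ud]] : exists U : set R, [/\ open U, M `<=` U &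
    (@lebesgue_measure R (U `\` M) < d%:E)%E].
  by apply: lebesgue_regularity_outer => //; rewrite [X in (X < _)%E]M0.
have {}Ud : (@lebesgue_measure R U < d%:E)%E.
  have mU : measurable U by exact: open_measurable.
  have mUM : measurable (U `\` M) by exact: measurableD.
  rewrite -(setDUK MU) measureU ?setDIK//.
  by rewrite [X in (X + _ < _)%E]M0 add0e.
pose P s t := exists l : seq (R * R), [/\ chain s t l,
  (forall p, p \in l -> `]p.1, p.2[ `<=` U) &
  g t - g s <= e1 * (t - s) + \sum_(p <- l) `|g p.2 - g p.1|].
have [l [cl lU gl]] : P lo hi.
  apply: cousin_induction => //.
    move=> x y z xy yz [l1 [c1 U1 g1]] [l2 [c2 U2 g2]]; exists (l1 ++ l2); split.
    - exact: chain_cat c2.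
    - by move=> p; rewrite mem_cat => /orP[/U1|/U2].
    - by rewrite big_cat/=; move: g1 g2; lra.
  move=> x /andP[lox xhi].
  have [Ux|Ux] := pselect (U x).
    have [r/= r0 rU] := oU x Ux; exists r => // y /andP[loy yhi] yx.
    have seg s t : s <= t -> x - r < s -> t < x + r -> P s t.
      move=> st xs tx; exists [:: (s, t)]; split => //=.
        by move=> p; rewrite inE => /eqP-> z /=; rewrite in_itv/= => /andP[sz zt];
          apply: rU; rewrite /ball/= ltr_norml; lra.
      rewrite big_seq1/=; apply: (le_trans (ler_norm _)).
      by rewrite lerDr mulr_ge0 ?subr_ge0 ?(ltW e10).
    by move: yx; rewrite ltr_norml => /andP[y1 y2]; split => yx; apply: seg; lra.
  have xlh : x \in `]lo, hi[.
    rewrite in_itv/= !lt_neqAle lox xhi !andbT; apply/andP; split; apply/eqP => xE;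
      apply: Ux; apply: MU; [left; right; exact: esym|right; exact: xE].
  have [l0 l00 dgx] : exists2 l, l <= 0 & is_derive x 1 g l.
    apply: contrapT => H; apply: Ux; apply: MU; left; left; apply: HN => /= K.
    by apply: H; exact: K.
  have [r r0 Hr] := is_derive_near dgx e10.
  exists r => // y /andP[loy yhi] yx; have := Hr y yx.
  split => xy; exists [::]; split => //=; rewrite big_nil addr0.
    move: H; rewrite ler_distl (ler0_norm (_ : y - x <= 0)) ?subr_le0// => /andP[+ _].
    have : 0 <= l0 * (y - x) by apply: mulr_le0 => //; rewrite subr_le0.
    lra.
  move: H; rewrite ler_distl (ger0_norm (_ : 0 <= y - x)) ?subr_ge0// => /andP[_].
  have : l0 * (y - x) <= 0 by apply: mulr_le0_ge0 => //; rewrite subr_ge0.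
  lra.
have lt_e : \sum_(p <- l) `|g p.2 - g p.1| < e / 2.
  rewrite (big_nth (0, 0)) big_mkord.
  apply: (Hd _ (fun i => (nth (0, 0) l i).1) (fun i => (nth (0, 0) l i).2)).
  - by move=> i; exact: chain_nth.
  - apply/trivIsetP => i j _ _ /eqP ij.
    suff H (i' j' : 'I_(size l)) : (i' < j')%N ->
      `](nth (0, 0) l i').1, (nth (0, 0) l i').2[ `&`
      `](nth (0, 0) l j').1, (nth (0, 0) l j').2[ = set0.
      have [|] := ltnP i j; first exact: H.
      rewrite leq_eqVlt => /predU1P[/esym/val_inj//|]; rewrite setIC; exact: H.
    move=> lij; rewrite -subset0 => x []/=; rewrite !in_itv/= => /andP[_ +] /andP[+ _].
    by have := chain_nth_le cl lij (ltn_ord _); lra.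
  - rewrite -(big_mkord xpredT (fun i => (nth (0, 0) l i).2 - (nth (0, 0) l i).1)).
    rewrite -(big_nth (0, 0) xpredT (fun p : R * R => p.2 - p.1)) -lte_fin.
    apply: le_lt_trans Ud; apply: le_trans (chain_measure oU cl lU) _.
    apply: le_measure; rewrite ?inE//; last exact: open_measurable.
    by apply: measurableI => //; exact: open_measurable.
have : e1 * (hi - lo) <= e / 2.
  rewrite /e1 mulrAC ler_pdivrMr; last lra.
  by rewrite ler_pM2l; lra.
lra.
Qed.

(** * Strong solutions of [- g'' = k] *)

#[local] Instance lebesgue_ae_filter (R : realType) :
  Filter (nbhs (almost_everywhere (@lebesgue_measure R))).
Proof. exact: (ae_filter_ringOfSetsType (@lebesgue_measure R)). Qed.

Lemma near_is_derive (R : realType) (g : R -> R) (x l : R) :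
  (forall e : R, 0 < e -> exists2 d : R, 0 < d & forall y, `|y - x| < d ->
    `|g y - g x - l * (y - x)| <= e * `|y - x|) ->
  is_derive x 1 g l.
Proof.
move=> H.
have cv : h^-1 *: ((g \o shift x) (h *: (1 : R)) - g x) @[h --> 0^'] --> l.
  apply/cvgrPdist_le => e e0; have [d d0 Hd] := H e e0.
  exists d => //= h; rewrite /ball_/= sub0r normrN => hd h0.
  have := Hd (h + x); rewrite addrK => /(_ hd) H1.
  rewrite [h *: 1]mulr1 -(@ler_pM2r _ `|h|) ?normr_gt0// -normrM -normrN.
  have -> : - ((l - h^-1 * (g (h + x) - g x)) * h) = g (h + x) - g x - l * h by field.
  exact: H1.
have dg : derivable g x 1 by apply/cvg_ex; exists l.
by apply: DeriveDef => //; exact/cvg_lim.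
Qed.

Lemma is_derive_comp_reflection (R : realType) (g : R -> R) (c x l : R) :
  is_derive (c - x) 1 g l -> is_derive x 1 (fun y => g (c - y)) (- l).
Proof.
move=> dg; apply: near_is_derive => e e0.
have [d d0 Hd] := is_derive_near dg e0; exists d => // y yx.
have E : c - y - (c - x) = - (y - x) by ring.
have := Hd (c - y); rewrite E normrN => /(_ yx).
by rewrite mulrN mulNr.
Qed.

Lemma measurable_reflection (R : realType) (c : R) :
  measurable_fun setT (fun x : R => c - x).
Proof. exact: measurable_funB. Qed.

(** The pushforward under the reflection agrees with Lebesgue measure on half-open intervals, which
    determine the measure. *)
Lemma lebesgue_measure_reflection (R : realType) (c : R) (A : set R) :
  measurable A ->
  @lebesgue_measure R ((fun x => c - x) @^-1` A) = @lebesgue_measure R A.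
Proof.
move=> mA; rewrite -[LHS]/(pushforward (@lebesgue_measure R)
  (fun x : R => (c - x) : measurableTypeR R) A).
apply/esym/lebesgue_measure_unique => //=; first exact: measurable_reflection.
move=> mf _ [[a b]] _ <-.
rewrite /pushforward.
have -> : (fun x : R => c - x) @^-1` `]a, b] = `[c - b, c - a[%classic.
  by apply/seteqP; split => x /=; rewrite !in_itv/= => /andP[? ?]; lra.
rewrite !lebesgue_measure_itv/= !lte_fin -!EFinD ltrD2l ltrN2.
by case: ifP => // _; congr EFin; ring.
Qed.

Lemma ae_reflection (R : realType) (c : R) (P : R -> Prop) :
  (\forall x \ae (@lebesgue_measure R), P x) ->
  \forall x \ae (@lebesgue_measure R), P (c - x).
Proof.
move=> [N [mN N0 HN]]; exists ((fun x : R => c - x) @^-1` N); split.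
- by rewrite -[X in measurable X]setTI; exact: measurable_reflection.
- by have := lebesgue_measure_reflection c mN; rewrite N0.
- by move=> x nP; apply: HN.
Qed.

Lemma absolutely_continuous_onD (R : realType) (lo hi : R) (g1 g2 : R -> R) :
  absolutely_continuous_on lo hi g1 -> absolutely_continuous_on lo hi g2 ->
  absolutely_continuous_on lo hi (fun x => g1 x + g2 x).
Proof.
move=> ac1 ac2 e e0; have e20 : 0 < e / 2 by lra.
have [d1 d10 H1] := ac1 _ e20; have [d2 d20 H2] := ac2 _ e20.
exists (Num.min d1 d2); first by rewrite lt_min d10.
move=> n a b ab tab; rewrite lt_min => /andP[s1 s2].
have := H1 n a b ab tab s1; have := H2 n a b ab tab s2.
suff : \sum_(i < n) `|g1 (b i) + g2 (b i) - (g1 (a i) + g2 (a i))| <=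
  \sum_(i < n) `|g1 (b i) - g1 (a i)| + \sum_(i < n) `|g2 (b i) - g2 (a i)| by lra.
rewrite -big_split/=; apply: ler_sum => i _.
by rewrite opprD addrACA ler_normD.
Qed.

Lemma absolutely_continuous_onN (R : realType) (lo hi : R) (g : R -> R) :
  absolutely_continuous_on lo hi g ->
  absolutely_continuous_on lo hi (fun x => - g x).
Proof.
move=> ac e e0; have [d d0 H] := ac e e0; exists d => // n a b ab tab s.
have := H n a b ab tab s; congr (_ < _); apply: eq_bigr => i _.
by rewrite -normrN; congr `|_|; ring.
Qed.

Lemma absolutely_continuous_on_reflection (R : realType) (lo hi c : R) (g : R -> R) :
  absolutely_continuous_on lo hi g ->
  absolutely_continuous_on (c - hi) (c - lo) (fun x => g (c - x)).
Proof.
move=> ac e e0; have [d d0 H] := ac e e0; exists d => // n a b ab tab s.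
have := H n (fun i => c - b i) (fun i => c - a i).
have -> : \sum_(i < n) `|g (c - b i) - g (c - a i)| =
          \sum_(i < n) `|g (c - a i) - g (c - b i)|.
  by apply: eq_bigr => i _; rewrite distrC.
apply.
- by move=> i; have [? ? ?] := ab i; split; lra.
- move=> i j _ _ [x []]; rewrite /= !in_itv/= => /andP[x1 x2] /andP[x3 x4].
  apply: tab => //; exists (c - x); split; rewrite /= in_itv/=; lra.
- by move: s; congr (_ < _); apply: eq_bigr => i _; ring.
Qed.

Lemma within_continuous_reflection (R : realType) (lo hi c : R) (g : R -> R) :
  {within `[lo, hi], continuous g} ->
  {within `[c - hi, c - lo], continuous (fun x => g (c - x))}.
Proof.
move=> /subspace_continuousP cg; apply/subspace_continuousP => x /=.
rewrite in_itv/= => /andP[x1 x2].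
have xI : [set` `[lo, hi]] (c - x) by rewrite /= in_itv/=; lra.
apply/cvgrPdist_le => e e0.
have /cvgrPdist_le/(_ e e0)[d/= d0 Hd] := cg _ xI.
exists d => //= y /= yx; rewrite in_itv/= => /andP[y1 y2]; apply: Hd => /=.
  by rewrite -normrN; move: yx; congr (_ < _); congr `|_|; ring.
by rewrite in_itv/=; lra.
Qed.

(** The boundary conditions are left out so that the notion survives restriction, linear combination
    and reflection. The derivative [dg] is a parameter because its values at the endpoints enter the
    Robin conditions. *)
Definition strong_solution (R : realType) (lo hi : R) (k g dg : R -> R) :=
  [/\ {within `[lo, hi], continuous g},
      forall x, x \in `]lo, hi[ -> is_derive x 1 g (dg x),
      absolutely_continuous_on lo hi dg &
      \forall x \ae (@lebesgue_measure R), x \in `]lo, hi[ ->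
        is_derive x 1 dg (- k x)].

Lemma strong_solution_sub (R : realType) (lo hi lo' hi' : R) (k g dg : R -> R) :
  lo <= lo' -> hi' <= hi ->
  strong_solution lo hi k g dg -> strong_solution lo' hi' k g dg.
Proof.
move=> lolo hihi [cg dgd ac ae].
have sub x : x \in `]lo', hi'[ -> x \in `]lo, hi[ by rewrite !in_itv/=; lra.
split.
- apply: continuous_subspaceW cg => x /=; rewrite !in_itv/=; lra.
- by move=> x /sub/dgd.
- exact: absolutely_continuous_on_sub ac.
- by apply: filterS ae => x H /sub/H.
Qed.

Lemma strong_solutionD (R : realType) (lo hi : R) (k1 g1 dg1 k2 g2 dg2 : R -> R) :
  strong_solution lo hi k1 g1 dg1 -> strong_solution lo hi k2 g2 dg2 ->
  strong_solution lo hi (fun x => k1 x + k2 x) (fun x => g1 x + g2 x)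
    (fun x => dg1 x + dg2 x).
Proof.
move=> [c1 d1 a1 e1] [c2 d2 a2 e2]; split.
- exact: within_continuousD c1 c2.
- by move=> x xI; have := d1 x xI; have := d2 x xI; move=> ? ?; exact: is_deriveD.
- exact: absolutely_continuous_onD.
- apply: filterS2 e1 e2 => x H1 H2 xI; rewrite opprD.
  by have := H1 xI; have := H2 xI; move=> ? ?; exact: is_deriveD.
Qed.

Lemma strong_solutionN (R : realType) (lo hi : R) (k g dg : R -> R) :
  strong_solution lo hi k g dg ->
  strong_solution lo hi (fun x => - k x) (fun x => - g x) (fun x => - dg x).
Proof.
move=> [c d a e]; split.
- by move=> x; apply: cvgN; exact: c.
- by move=> x xI; have := d x xI => ?; exact: is_deriveN.
- exact: absolutely_continuous_onN.
- by apply: filterS e => x H xI; have := H xI => ?; exact: is_deriveN.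
Qed.

Lemma strong_solutionB (R : realType) (lo hi : R) (k1 g1 dg1 k2 g2 dg2 : R -> R) :
  strong_solution lo hi k1 g1 dg1 -> strong_solution lo hi k2 g2 dg2 ->
  strong_solution lo hi (fun x => k1 x - k2 x) (fun x => g1 x - g2 x)
    (fun x => dg1 x - dg2 x).
Proof. by move=> s1 /strong_solutionN; exact: strong_solutionD. Qed.

(** The chain rule changes the sign of the first derivative only; in the second derivative the two
    signs cancel. *)
Lemma strong_solution_reflection (R : realType) (lo hi c : R) (k g dg : R -> R) :
  strong_solution lo hi k g dg ->
  strong_solution (c - hi) (c - lo) (fun x => k (c - x)) (fun x => g (c - x))
    (fun x => - dg (c - x)).
Proof.
have sub x : x \in `]c - hi, c - lo[ -> c - x \in `]lo, hi[ by rewrite !in_itv/=; lra.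
move=> [cg d a e]; split.
- exact: within_continuous_reflection.
- by move=> x /sub/d/is_derive_comp_reflection.
- exact/absolutely_continuous_onN/absolutely_continuous_on_reflection.
- apply: filterS (ae_reflection c e) => x H /sub/H/is_derive_comp_reflection.
  by rewrite (opprK (k (c - x))) => K; apply: (is_deriveN K).
Qed.

(** [dg] is absolutely continuous with derivative [- k <= 0] almost everywhere, hence nonincreasing,
    and the mean value theorem turns this into the tangent inequality, endpoints included. Applied
    to both [g] and [- g] when [k = 0], it shows that [g] is affine. *)
Lemma strong_solution_concave (R : realType) (lo hi : R) (k g dg : R -> R) :
  strong_solution lo hi k g dg ->
  (\forall x \ae (@lebesgue_measure R), x \in `]lo, hi[ -> 0 <= k x) ->
  {in `[lo, hi] &, forall x y, x <= y -> dg y <= dg x} /\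
  {in `[lo, hi] &, forall x y, g y <= g x + dg x * (y - x)}.
Proof.
move=> [cg d a e] k0.
have mono : {in `[lo, hi] &, forall x y, x <= y -> dg y <= dg x}.
  move=> x y; rewrite !in_itv/= => /andP[lox xhi] /andP[loy yhi] xy.
  apply: (@absolutely_continuous_derive_le0 _ x y) => //.
    exact: absolutely_continuous_on_sub a.
  apply: filterS2 e k0 => z H1 H2 zI.
  have zI' : z \in `]lo, hi[ by move: zI; rewrite !in_itv/=; lra.
  by exists (- k z); [rewrite oppr_le0; exact: H2|exact: H1].
split=> // x y xI yI.
have mvt s t : s \in `[lo, hi] -> t \in `[lo, hi] -> s <= t ->
    exists2 c, c \in `[s, t] & g t - g s = dg c * (t - s).
  rewrite !in_itv/= => sI tI st.
  have d' z : z \in `]s, t[ -> is_derive z 1 g (dg z).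
    by move=> zI; apply: d; move: zI sI tI; rewrite !in_itv/=; lra.
  apply: (@MVT_segment R g dg s t st d').
  apply: continuous_subspaceW cg => z /=.
  by rewrite !in_itv/=; lra.
have [xy|/ltW yx] := leP x y.
  have [c cI E] := mvt x y xI yI xy.
  rewrite -lerBlDl E ler_wpM2r ?subr_ge0//.
  by apply: mono => //; move: xI yI cI; rewrite !in_itv/=; lra.
have [c cI E] := mvt y x yI xI yx.
have : dg x * (x - y) <= dg c * (x - y).
  rewrite ler_wpM2r ?subr_ge0//.
  by apply: mono => //; move: xI yI cI; rewrite !in_itv/=; lra.
by move: E; lra.
Qed.

Lemma robin_solution_strong (R : realType) (alpha : R) (f u : R -> R) :
  robin_solution alpha f u -> exists du : R -> R,
    [/\ strong_solution (- pi) pi f u du, du (- pi) = alpha * u (- pi) &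
        du pi = - (alpha * u pi)].
Proof.
move=> [du [[hd _ ac] ae bl br]]; exists du.
have D x : x \in `[- pi, pi] -> forall e : R, 0 < e -> exists2 d : R, 0 < d &
    forall y, y \in `[- pi, pi] -> `|y - x| < d ->
    `|u y - u x - du x * (y - x)| <= e * `|y - x|.
  move=> xI e e0; have /cvgrPdist_le/(_ e e0)[d/= d0 Hd] := hd x xI.
  exists d => // y yI yx.
  have [->|yneq] := eqVneq y x; first by rewrite !subrr mulr0 subr0 !normr0 mulr0.
  have yx0 : y - x != 0 by rewrite subr_eq0.
  have := Hd y; rewrite /= distrC => /(_ yx yneq yI).
  rewrite -(@ler_pM2r _ `|y - x|) ?normr_gt0// -normrM; congr (_ <= _).
  by rewrite -normrN; congr `|_|; field.
split; [|lra|lra]; split => //.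
- apply/subspace_continuousP => x xI; apply/cvgrPdist_le => e e0.
  have [d d0 Hd] := D x xI 1 ltr01.
  (* The increment of [u] is at most [(1 + |du x|) * |y - x|] within distance [d]. *)
  exists (Num.min d (e / (1 + `|du x|))) => /=.
    by rewrite lt_min d0 divr_gt0// ltr_wpDr.
  move=> y /=; rewrite distrC lt_min => /andP[yd ye] yI; rewrite distrC.
  have := Hd y yI yd; rewrite mul1r => H.
  have : `|u y - u x| <= `|u y - u x - du x * (y - x)| + `|du x * (y - x)|.
    by rewrite -[leLHS]/(`|u y - u x|) -{1}(subrK (du x * (y - x)) (u y - u x)) ler_normD.
  rewrite normrM.
  move: ye; rewrite ltr_pdivlMr; last by rewrite ltr_wpDr.
  by lra.
- move=> x xI; apply: near_is_derive => e e0.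
  have xI' : x \in `[- pi, pi] by move: xI; rewrite !in_itv/=; lra.
  have [d d0 Hd] := D x xI' e e0.
  move: xI; rewrite in_itv/= => /andP[x1 x2].
  (* This radius keeps [y] inside the interval, so that the derivative within it becomes
     two-sided. *)
  exists (Num.min d (Num.min (x + pi) (pi - x))).
    by rewrite !lt_min d0/=; lra.
  move=> y; rewrite !lt_min => /and3P[yd y1 y2]; apply: Hd => //.
  by move: y1 y2; rewrite !ltr_norml in_itv/=; lra.
Qed.

Lemma is_derive_eq0 (R : realType) (lo hi x l : R) (g : R -> R) :
  x \in `]lo, hi[ -> {in `]lo, hi[, forall y, g y = 0} ->
  is_derive x 1 g l -> l = 0.
Proof.
move=> xI g0 dg; apply/eqP; rewrite -normr_le0; apply/ler_addgt0Pl => e e0.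
rewrite addr0; have [d d0 Hd] := is_derive_near dg e0.
have gx := g0 x xI; move: xI; rewrite in_itv/= => /andP[x1 x2].
pose r := Num.min (d / 2) ((hi - x) / 2).
have r0 : 0 < r by rewrite lt_min; apply/andP; split; lra.
have r1 : r <= d / 2 by rewrite ge_min lexx.
have r2 : r <= (hi - x) / 2 by rewrite ge_min lexx orbT.
have := Hd (x + r); rewrite [x + r - x]addrAC subrr add0r (gtr0_norm r0).
rewrite gx (g0 (x + r)) ?in_itv/=; last by lra.
rewrite subrr sub0r normrN normrM (gtr0_norm r0) ler_pM2r//; apply; lra.
Qed.

Lemma ae_itvoo_itvcc (R : realType) (lo hi : R) (P : R -> Prop) :
  (\forall x \ae (@lebesgue_measure R), x \in `]lo, hi[ -> P x) ->
  \forall x \ae (@lebesgue_measure R), x \in `[lo, hi] -> P x.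
Proof.
have ne (c : R) : \forall x \ae (@lebesgue_measure R), x != c.
  exists [set c]; split => //; first exact: lebesgue_measure_set1.
  by move=> x /= /negP; rewrite negbK => /eqP.
move=> H; apply: filterS3 H (ne lo) (ne hi) => x H xlo xhi xI; apply: H.
by move: xI; rewrite !in_itv/= !lt_neqAle eq_sym xlo xhi.
Qed.

(** * Comparison of the solutions *)

Section comparison.
Context {R : realType} {alpha b : R} {f u du v dv : R -> R}.
Hypotheses (alpha0 : 0 < alpha) (b0 : 0 < b) (bpi : b < pi)
  (f0 : \forall x \ae (@lebesgue_measure R), x \in `]- pi, pi[ -> 0 <= f x)
  (Su : strong_solution (- pi) pi f u du)
  (Sv : strong_solution (- pi) pi (polarization b f) v dv)
  (ul : du (- pi) = alpha * u (- pi)) (ur : du pi = - (alpha * u pi))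
  (vl : dv (- pi) = alpha * v (- pi)) (vr : dv pi = - (alpha * v pi)).

Let h x := polarization b f x - f x.
Let w x := v x - u x.
Let dw x := dv x - du x.
Let a := 2 * b - pi.
Let m := w (- pi).

Let Sw : strong_solution (- pi) pi h w dw.
Proof. exact: strong_solutionB. Qed.

Let pi0 : 0 < pi :> R. Proof. exact: pi_gt0. Qed.

Let bounds : [/\ 0 < alpha, 0 < b, b < pi & 0 < pi :> R]. Proof. by []. Qed.

Let h_left x : x < a -> h x = 0.
Proof. by move=> xa; rewrite /h /polarization b0 xa subrr. Qed.

Let h_ge0 x : x < b -> 0 <= h x.
Proof.
move=> xb; rewrite /h /polarization b0; case: ifP => _; first by rewrite subrr.
by rewrite (ltW xb) subr_ge0 le_max lexx.
Qed.

Let h_anti x : a < x -> x < b -> h x + h (2 * b - x) = 0.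
Proof.
have [alpha_gt0 b_gt0 b_ltpi pi_gt0] := bounds.
move=> ax xb; rewrite /h /polarization b0.
have -> : 2 * b - (2 * b - x) = x by ring.
have -> : x < 2 * b - pi = false by apply/negbTE; rewrite -leNgt ltW.
have -> : 2 * b - x < 2 * b - pi = false by apply/negbTE; rewrite -leNgt; lra.
have -> : 2 * b - x <= b = false by apply/negbTE; rewrite -ltNge; lra.
rewrite (ltW xb) minC; have := addr_max_min (f x) (f (2 * b - x)); lra.
Qed.

Let polarization_ge x : a < x -> x < b -> 0 <= polarization b f x - f (2 * b - x).
Proof.
move=> ax xb; rewrite /polarization b0.
have -> : x < 2 * b - pi = false by apply/negbTE; rewrite -leNgt ltW.
by rewrite (ltW xb) subr_ge0 le_max lexx orbT.
Qed.

(** The source [h] vanishes left of [a], so [w] and [- w] are both concave there and [w] equals its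
    tangent at [- pi]. The slope comes from the left Robin condition. *)
Let w_affine x : - pi <= x -> x <= a -> w x = m * (1 + alpha * (x + pi)) /\ dw x = alpha * m.
Proof.
have [alpha_gt0 b_gt0 b_ltpi pi_gt0] := bounds.
move=> x1 x2.
have S : strong_solution (- pi) a h w dw.
  by apply: strong_solution_sub Sw => //; rewrite /a; lra.
have [] := strong_solution_concave S.
  by apply: aeW => y; rewrite in_itv/= => /andP[_ /h_left->].
have [] := strong_solution_concave (strong_solutionN S).
  by apply: aeW => y; rewrite in_itv/= => /andP[_ /h_left->]; rewrite oppr0.
have pI : - pi \in `[- pi, a] by rewrite in_itv/= lexx/=; lra.
have xI : x \in `[- pi, a] by rewrite in_itv/= x1.
move=> M1 T1 M2 T2.
have := M1 _ _ pI xI x1; have := M2 _ _ pI xI x1.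
have := T1 _ _ pI xI; have := T2 _ _ pI xI.
have -> : dw (- pi) = alpha * m by rewrite /dw ul vl /m /w; ring.
rewrite -/m; move=> *; split; lra.
Qed.

(** By [h_anti] the sum of [w] and its reflection has zero source on []a, b[], hence is affine. Its
    slope vanishes at the fixed point [b], hence everywhere; at [a] this reads [dw a = dw pi]. *)
Let w_sym x : a <= x -> x <= b -> w x + w (2 * b - x) = 2 * w b /\ dw a = dw pi.
Proof.
have [alpha_gt0 b_gt0 b_ltpi pi_gt0] := bounds.
move=> x1 x2.
have S1 : strong_solution a b h w dw.
  by apply: strong_solution_sub Sw => //; rewrite /a; lra.
have S2 := strong_solution_reflection (2 * b) Sw.
have {}S2 := @strong_solution_sub _ _ _ a b _ _ _ (lexx _) _ S2.
have {}S2 := S2 (ltac:(lra)).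
have S := strong_solutionD S1 S2.
have [] := strong_solution_concave S.
  by apply: aeW => y; rewrite in_itv/= => /andP[y1 y2]; rewrite h_anti.
have [] := strong_solution_concave (strong_solutionN S).
  by apply: aeW => y; rewrite in_itv/= => /andP[y1 y2]; rewrite h_anti// oppr0.
have bb : 2 * b - b = b by ring.
have aa : 2 * b - a = pi by rewrite /a; ring.
have ab : a <= b by rewrite /a; lra.
have aI : a \in `[a, b] by rewrite in_itv/= lexx ab.
have bI : b \in `[a, b] by rewrite in_itv/= lexx ab.
have xI : x \in `[a, b] by rewrite in_itv/= x1.
move=> M1 T1 M2 T2.
have := M1 _ _ aI bI ab; have := M2 _ _ aI bI ab.
have := T1 _ _ bI xI; have := T2 _ _ bI xI.
rewrite bb aa subrr oppr0 !mul0r !addr0 => *; split; lra.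
Qed.

(** The right Robin condition and [dw pi = dw a = alpha * m] give [w pi = - m]. Then
    [2 * w b = w a + w pi], where [w a = m * (1 + 2 * alpha * b)]. *)
Let w_b : w b = alpha * b * m.
Proof.
have [alpha_gt0 b_gt0 b_ltpi pi_gt0] := bounds.
have ab : a <= b by rewrite /a; lra.
have pa : - pi <= a by rewrite /a; lra.
have [wa dwa] := w_affine pa (lexx _).
have [s1 ds] := w_sym (lexx _) ab.
have wpi : w pi = - m.
  apply: (mulfI (lt0r_neq0 alpha0)); rewrite mulrN -dwa ds /dw ur vr /w; ring.
move: s1; have -> : 2 * b - a = pi by rewrite /a; ring.
by rewrite wa wpi /a; lra.
Qed.

Let w_concave :
  {in `[- pi, b] &, forall x y, w y <= w x + dw x * (y - x)}.
Proof.
have [alpha_gt0 b_gt0 b_ltpi pi_gt0] := bounds.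
have S : strong_solution (- pi) b h w dw.
  by apply: strong_solution_sub Sw => //; lra.
have [] // := strong_solution_concave S.
by apply: aeW => y; rewrite in_itv/= => /andP[_ /h_ge0].
Qed.

Let dw_left : dw (- pi) = alpha * m.
Proof. by rewrite /dw ul vl /m /w; ring. Qed.

Let pI : - pi \in `[- pi, b].
Proof. by have [alpha_gt0 b_gt0 b_ltpi pi_gt0] := bounds; rewrite in_itv/= lexx/=; lra. Qed.

Let bI : b \in `[- pi, b].
Proof. by have [alpha_gt0 b_gt0 b_ltpi pi_gt0] := bounds; rewrite in_itv/= lexx/= andbT; lra. Qed.

Let alphapi : 0 < 1 + alpha * pi.
Proof. by rewrite addr_gt0// mulr_gt0. Qed.

(** The tangent of [w] at [- pi], evaluated at [b], gives [alpha * b * m <= m + alpha * m * (b +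
    pi)], that is, [0 <= m * (1 + alpha * pi)]. *)
Let m_ge0 : 0 <= m.
Proof.
have [alpha_gt0 b_gt0 b_ltpi pi_gt0] := bounds.
have := w_concave pI bI; rewrite dw_left w_b -/m => H.
by rewrite -(pmulr_lge0 _ alphapi); lra.
Qed.

Let w_ge0 x : x \in `[- pi, b] -> 0 <= w x.
Proof.
have [alpha_gt0 b_gt0 b_ltpi pi_gt0] := bounds.
move=> xI; have wb : 0 <= w b by rewrite w_b !mulr_ge0// ltW.
have := w_concave xI pI; have := w_concave xI bI; have := m_ge0; rewrite /m.
move: xI; rewrite in_itv/= => /andP[x1 x2] H0 H1 H2.
(* The tangent at [x] is followed towards the end where it does not rise; the value of [w] at that
   end is nonnegative. *)
have [d0|/ltW d0] := leP 0 (dw x).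
  have : dw x * (- pi - x) <= 0 by rewrite mulr_ge0_le0//; lra.
  lra.
have : dw x * (b - x) <= 0 by rewrite mulr_le0_ge0//; lra.
lra.
Qed.

(** The tangents at both ends, with the Robin slopes, bound each end value by [1 + 2 * alpha * pi]
    times the other. If [u pi] were negative, so would be [u (- pi)], and adding the two bounds
    gives a contradiction. *)
Let u_pi_ge0 : 0 <= u pi.
Proof.
have [alpha_gt0 b_gt0 b_ltpi pi_gt0] := bounds.
have [_ T] := strong_solution_concave Su f0.
have lI : - pi \in `[- pi, pi :> R] by rewrite in_itv/= lexx/=; lra.
have rI : pi \in `[- pi, pi :> R] by rewrite in_itv/= lexx/= andbT; lra.
have := T _ _ lI rI; have := T _ _ rI lI; rewrite ul ur => H1 H2.
rewrite leNgt; apply/negP => up.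
have ap : 0 < alpha * pi by rewrite mulr_gt0.
have p1 : alpha * pi * u pi < 0 by rewrite pmulr_rlt0.
have u0 : u (- pi) < 0 by lra.
have p2 : alpha * pi * u (- pi) < 0 by rewrite pmulr_rlt0.
lra.
Qed.

(** Suppose that the concave function [z = v - u o sigma] is negative at [a]. Since
    [z b = w b >= 0], its slope at [a] is positive, so [dv a > alpha * u pi >= 0]. On [[- pi, a]]
    the function [v] is concave, which gives [dv a <= alpha * v (- pi) <= alpha * v a < alpha * u
    pi], a contradiction. *)
Let z_left : 0 <= v a - u pi.
Proof.
have [alpha_gt0 b_gt0 b_ltpi pi_gt0] := bounds.
rewrite leNgt; apply/negP => z0.
have ab : a < b by rewrite /a; lra.
have S1 : strong_solution a b (polarization b f) v dv.
  by apply: strong_solution_sub Sv => //; rewrite /a; lra.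
have S2 := strong_solution_reflection (2 * b) Su.
have {}S2 := @strong_solution_sub _ _ _ a b _ _ _ (lexx _) _ S2.
have {}S2 := S2 (ltac:(lra)).
have [|_ T] := strong_solution_concave (strong_solutionB S1 S2).
  by apply: aeW => y; rewrite in_itv/= => /andP[y1 y2]; exact: polarization_ge.
have Sva : strong_solution (- pi) a (polarization b f) v dv.
  by apply: strong_solution_sub Sv => //; rewrite /a; lra.
have [|M' T'] := strong_solution_concave Sva.
  apply: filterS f0 => y H; rewrite in_itv/= => /andP[y1 y2].
  rewrite /polarization b0 -/a y2; apply: H; rewrite in_itv/= y1/=.
  by move: y2; rewrite /a; lra.
have aI : a \in `[a, b] by rewrite in_itv/= lexx ltW.
have bI' : b \in `[a, b] by rewrite in_itv/= lexx ltW.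
have := T _ _ aI bI'.
have -> : 2 * b - b = b by ring.
have -> : 2 * b - a = pi by rewrite /a; ring.
have wb : 0 <= w b by exact: w_ge0.
rewrite ur => H.
have d0 : 0 < (dv a - - - (alpha * u pi)) * (b - a) by move: wb; rewrite /w; lra.
rewrite pmulr_lgt0 in d0; last by lra.
have aI' : a \in `[- pi, a] by rewrite in_itv/= lexx/= andbT /a; lra.
have pI' : - pi \in `[- pi, a] by rewrite in_itv/= lexx/= /a; lra.
have pa : - pi <= a by rewrite /a; lra.
have M := M' _ _ pI' aI' pa.
have {}T := T' _ _ aI' pI'.
have u0 : 0 <= alpha * u pi by rewrite mulr_ge0// ltW.
have : dv a * (- pi - a) <= 0 by rewrite mulr_ge0_le0 /a; lra.
move=> K; have va : v (- pi) <= v a by lra.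
have : alpha * v (- pi) <= alpha * v a by rewrite ler_pM2l.
have : alpha * v a < alpha * u pi by rewrite ltr_pM2l//; lra.
by rewrite vl in M; lra.
Qed.

Let z_ge0 x : x \in `[a, b] -> u (2 * b - x) <= v x.
Proof.
have [alpha_gt0 b_gt0 b_ltpi pi_gt0] := bounds.
move=> xI; rewrite -subr_ge0.
have ab : a < b by rewrite /a; lra.
have S1 : strong_solution a b (polarization b f) v dv.
  by apply: strong_solution_sub Sv => //; rewrite /a; lra.
have S2 := strong_solution_reflection (2 * b) Su.
have {}S2 := @strong_solution_sub _ _ _ a b _ _ _ (lexx _) _ S2.
have {}S2 := S2 (ltac:(lra)).
have [|_ T] := strong_solution_concave (strong_solutionB S1 S2).
  by apply: aeW => y; rewrite in_itv/= => /andP[y1 y2]; exact: polarization_ge.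
have aI : a \in `[a, b] by rewrite in_itv/= lexx ltW.
have bI' : b \in `[a, b] by rewrite in_itv/= lexx ltW.
have := T _ _ xI bI'; have := T _ _ xI aI.
have -> : 2 * b - b = b by ring.
have -> : 2 * b - a = pi by rewrite /a; ring.
have wb : 0 <= v b - u b by exact: w_ge0.
have := z_left; move: xI; rewrite in_itv/= => /andP[x1 x2].
rewrite -[dv x - _]/(dv x - - du (2 * b - x)); set d := dv x - - du (2 * b - x).
have [d0|/ltW d0] := leP 0 d.
  have : d * (a - x) <= 0 by rewrite mulr_ge0_le0//; lra.
  lra.
have : d * (b - x) <= 0 by rewrite mulr_le0_ge0//; lra.
lra.
Qed.

Lemma polarization_sum_le x : x \in `[2 * b - pi, b] ->
  u x + u (2 * b - x) <= v x + v (2 * b - x).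
Proof.
have [alpha_gt0 b_gt0 b_ltpi pi_gt0] := bounds.
rewrite in_itv/= => /andP[x1 x2]; have [] := w_sym x1 x2.
by have := w_ge0 bI; rewrite /w; lra.
Qed.

Lemma polarization_max_le x : x \in `[2 * b - pi, b] -> u (2 * b - x) <= v x.
Proof. exact: z_ge0. Qed.

Lemma polarization_left_le x : x \in `[- pi, b] -> u x <= v x.
Proof. by move=> /w_ge0; rewrite /w subr_ge0. Qed.

Lemma polarization_left_lt x : u (- pi) != v (- pi) ->
  x \in `[- pi, 2 * b - pi] -> u x < v x.
Proof.
have [alpha_gt0 b_gt0 b_ltpi pi_gt0] := bounds.
rewrite in_itv/= => uv /andP[x1 x2]; have [wx _] := w_affine x1 x2.
have m0 : 0 < m by rewrite lt_neqAle m_ge0 andbT eq_sym /m /w subr_eq0 eq_sym.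
rewrite -subr_gt0 -/(w x) wx mulr_gt0// ltr_pwDl// mulr_ge0//; lra.
Qed.

(** When [m = 0] the tangent of [w] at [- pi] is the zero function, so concavity and [w_ge0] force
    [w = 0] up to [b]; [w_sym] carries this beyond [b]. *)
Lemma eq_left_end_eq : u (- pi) = v (- pi) -> {in `[- pi, pi], u =1 v}.
Proof.
have [alpha_gt0 b_gt0 b_ltpi pi_gt0] := bounds.
move=> uv; have m0 : m = 0 by rewrite /m /w uv subrr.
have wl x : x \in `[- pi, b] -> w x = 0.
  move=> xI; have := w_concave pI xI; have := w_ge0 xI.
  by rewrite dw_left -/m m0; lra.
move=> x; rewrite in_itv/= => /andP[x1 x2]; apply/esym/eqP; rewrite -subr_eq0; apply/eqP.
rewrite -/(w x); have [xb|bx] := leP x b; first by apply: wl; rewrite in_itv/= x1.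
have [] := @w_sym (2 * b - x); [by rewrite /a; lra|by lra|].
have -> : 2 * b - (2 * b - x) = x by ring.
rewrite w_b m0 (wl (2 * b - x)); last by rewrite in_itv/=; lra.
lra.
Qed.

(** Forward, [w = 0] makes [dw] and then [h] vanish almost everywhere. Backward, [h = 0] makes [- w]
    concave too, and the computation of [m_ge0] with the opposite sign yields [m <= 0]. *)
Lemma eq_left_end_polarization : u (- pi) = v (- pi) <->
  \forall x \ae (@lebesgue_measure R), x \in `[- pi, pi] -> f x = polarization b f x.
Proof.
have [alpha_gt0 b_gt0 b_ltpi pi_gt0] := bounds.
split=> [uv|H].
  have [_ dwE _ ae] := Sw; apply: ae_itvoo_itvcc; apply: filterS ae => x H xI.
  have w0 : {in `]- pi, pi[, forall y, w y = 0}.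
    move=> y yI; rewrite /w (eq_left_end_eq uv) ?subrr//.
    by move: yI; rewrite !in_itv/=; lra.
  have dw0 : {in `]- pi, pi[, forall y, dw y = 0}.
    by move=> y yI; exact: is_derive_eq0 yI w0 (dwE y yI).
  have := is_derive_eq0 xI dw0 (H xI).
  by rewrite /h; lra.
have S : strong_solution (- pi) b h w dw.
  by apply: strong_solution_sub Sw => //; lra.
have [|_ T] := strong_solution_concave (strong_solutionN S).
  apply: filterS H => x H xI; rewrite /h H ?subrr ?oppr0//.
  by move: xI; rewrite !in_itv/=; lra.
have := T _ _ pI bI; rewrite dw_left w_b -/m => K.
have m0 : m <= 0 by rewrite -(pmulr_lle0 _ alphapi); lra.
by have := m_ge0; move: m0; rewrite /m /w; lra.
Qed.

End comparison.

(** * Convex functions and integrals *)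

(** With the denominators cleared, the degenerate case [x = z] is included. *)
Lemma convex_function_chord (R : realType) (phi : R -> R) (x y z : R) :
  convex_function (setT : set R^o) phi -> x <= y -> y <= z ->
  (z - x) * phi y <= (z - y) * phi x + (y - x) * phi z.
Proof.
move=> cphi xy yz; have [xz|zx] := ltP x z; last first.
  have -> : y = x by lra.
  have -> : z = x by lra.
  by rewrite !subrr !mul0r addr0.
have zx0 : 0 < z - x by rewrite subr_gt0.
pose t := (z - y) / (z - x).
have t0 : 0 <= t by rewrite divr_ge0//; lra.
have t1 : t <= 1 by rewrite ler_pdivrMr//; lra.
have : phi (t * x + (1 - t) * z) <= t * phi x + (1 - t) * phi z.
  exact: (cphi (Itv01 t0 t1) x z (mem_set I) (mem_set I)).
have -> : t * x + (1 - t) * z = y by rewrite /t; field; rewrite gt_eqF.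
rewrite -(ler_pM2l zx0); congr (_ <= _); rewrite /t; field.
by rewrite gt_eqF.
Qed.

Lemma convex_nondecreasing_continuous (R : realType) (phi : R -> R) :
  convex_function (setT : set R^o) phi -> {homo phi : x y / x <= y} ->
  continuous phi.
Proof.
move=> cphi mphi x; apply/cvgrPdist_le => e e0.
(* By convexity the slope of the chord over [[x, x + 1]] bounds the increments of [phi] from [x] on
   both sides; monotonicity settles their signs. *)
pose K := phi (x + 1) - phi x.
have K0 : 0 <= K by rewrite subr_ge0 mphi// lerDl.
exists (Num.min 1 (e / (K + 1))) => /=.
  by rewrite lt_min ltr01 divr_gt0// ltr_wpDl.
move=> y /=; rewrite lt_min => /andP[y1]; rewrite ltr_pdivlMr ?ltr_wpDl// => ye.
suff : `|phi x - phi y| <= K * `|x - y| by have := normr_ge0 (x - y); lra.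
have [xy|/ltW yx] := leP x y.
  rewrite !ler0_norm ?subr_le0 ?mphi//; move: y1; rewrite ler0_norm ?subr_le0// => y1.
  have := @convex_function_chord _ phi x y (x + 1) cphi xy (ltac:(lra)).
  by rewrite /K; lra.
rewrite !ger0_norm ?subr_ge0 ?mphi//; move: y1; rewrite ger0_norm ?subr_ge0// => y1.
have := @convex_function_chord _ phi y x (x + 1) cphi yx (ltac:(lra)).
by rewrite /K; lra.
Qed.

(** If [p] or [q] is at most [t], monotonicity suffices. Otherwise both lie between [t] and [s], and
    the sum of the two chord bounds exceeds [phi s + phi t] by a nonpositive multiple of
    [phi s - phi t]. *)
Lemma convex_weak_majorization (R : realType) (phi : R -> R) (p q s t : R) :
  convex_function (setT : set R^o) phi -> {homo phi : x y / x <= y} ->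
  p <= s -> q <= s -> p + q <= s + t -> phi p + phi q <= phi s + phi t.
Proof.
move=> cphi mphi ps qs pqst.
have [qt|tq] := leP q t; first by rewrite lerD ?mphi.
have [pt|tp] := leP p t; first by rewrite addrC lerD ?mphi.
have st0 : 0 < s - t by lra.
have := convex_function_chord cphi (ltW tp) ps.
have := convex_function_chord cphi (ltW tq) qs.
have : (s + t - p - q) * (phi t - phi s) <= 0.
  by rewrite mulr_ge0_le0 ?subr_le0 ?mphi//; lra.
by move=> *; rewrite -(ler_pM2l st0); lra.
Qed.

(** * Integrals of continuous functions over compact intervals *)

Lemma within_continuous_integrable (R : realType) (lo hi : R) (k : R -> R) :
  {within `[lo, hi], continuous k} ->
  (@lebesgue_measure R).-integrable `[lo, hi] (EFin \o k).
Proof.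
by move=> ck; apply: continuous_compact_integrable => //; exact: segment_compact.
Qed.

Lemma Rintegral_reflection (R : realType) (lo hi c : R) (k : R -> R) :
  lo <= hi -> {within `[c - hi, c - lo], continuous k} ->
  \int[@lebesgue_measure R]_(x in `[c - hi, c - lo]) k x =
  \int[@lebesgue_measure R]_(x in `[lo, hi]) k (c - x).
Proof.
move=> lohi ck; rewrite /Rintegral; congr fine.
have D x : is_derive x (1 : R) (fun y : R => c - y) (- 1).
  exact: is_derive_comp_reflection.
have D1 : derive1 (fun y : R => c - y) = cst (- 1 : R).
  by apply/funext => x; rewrite derive1E; have := D x => ?; rewrite derive_val.
rewrite (@integration_by_substitution_decreasing R (fun y => c - y) k lo hi)//.
- by apply: eq_integral => x _; rewrite /= !fctE D1/= opprK mulr1.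
- by move=> x y _ _ xy; rewrite ltrD2l ltrN2.
- by rewrite D1 => x _; exact: cvg_cst.
- by rewrite D1; exact: is_cvg_cst.
- by rewrite D1; exact: is_cvg_cst.
- have C x : {for x, continuous (fun y : R => c - y)}.
    by apply: differentiable_continuous; apply/derivable1_diffP; have [] := D x.
  split => //.
  + by apply: cvg_at_right_filter; exact: C.
  + by apply: cvg_at_left_filter; exact: C.
Qed.

Lemma Rintegral_fold (R : realType) (lo b hi : R) (k : R -> R) :
  lo <= 2 * b - hi -> b <= hi -> {within `[lo, hi], continuous k} ->
  \int[@lebesgue_measure R]_(x in `[lo, hi]) k x =
  \int[@lebesgue_measure R]_(x in `[lo, 2 * b - hi]) k x +
  \int[@lebesgue_measure R]_(x in `[2 * b - hi, b]) (k x + k (2 * b - x)).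
Proof.
move=> lob bhi ck.
have ckS l h : lo <= l -> h <= hi -> {within `[l, h], continuous k}.
  move=> ll hh; apply: continuous_subspaceW ck => x /=; rewrite !in_itv/=; lra.
have split l m h : lo <= l -> h <= hi -> l <= m -> m <= h ->
    \int[@lebesgue_measure R]_(x in `[l, h]) k x =
    \int[@lebesgue_measure R]_(x in `[l, m]) k x +
    \int[@lebesgue_measure R]_(x in `[m, h]) k x.
  move=> ll hh lm mh.
  have := @Rintegral_itvB R k (BLeft l) (BRight h) m
    (within_continuous_integrable (ckS _ _ ll hh)).
  rewrite !bnd_simp => /(_ lm mh) E.
  rewrite -(@Rintegral_itv_obnd_cbnd R m (BRight h) k) -?E; first lra.
  have mlo : lo <= m by lra.
  apply: integrableS (within_continuous_integrable (ckS m h mlo hh)) => //.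
  by move=> x /=; rewrite !in_itv/= => /andP[/ltW-> ->].
have ab : 2 * b - hi <= b by lra.
have ahi : 2 * b - hi <= hi by lra.
rewrite (split lo (2 * b - hi) hi)// (split (2 * b - hi) b hi)//; congr (_ + _).
rewrite RintegralD//.
- congr (_ + _).
  have := @Rintegral_reflection R (2 * b - hi) b (2 * b) k ab.
  have -> : 2 * b - b = b by ring.
  have -> : 2 * b - (2 * b - hi) = hi by ring.
  by apply; apply: ckS => //; lra.
- by apply: within_continuous_integrable; apply: ckS.
- apply: within_continuous_integrable.
  have := @within_continuous_reflection R b hi (2 * b) k.
  have -> : 2 * b - b = b by ring.
  by apply; apply: ckS => //; lra.
Qed.

(** The continuous difference attains a positive minimum, so the integrals differ by at least this
    minimum times the length. *)
Lemma Rintegral_lt (R : realType) (lo hi : R) (k1 k2 : R -> R) :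
  lo < hi -> {within `[lo, hi], continuous k1} ->
  {within `[lo, hi], continuous k2} -> {in `[lo, hi], forall x, k1 x < k2 x} ->
  \int[@lebesgue_measure R]_(x in `[lo, hi]) k1 x <
  \int[@lebesgue_measure R]_(x in `[lo, hi]) k2 x.
Proof.
move=> lohi c1 c2 k12.
have [c cI cmin] := EVT_min (ltW lohi) (within_continuousB c2 c1).
have c0 : 0 < k2 c - k1 c by rewrite subr_gt0; exact: k12.
have ccst : {within `[lo, hi], continuous (cst (k2 c - k1 c) : R -> R)}.
  by move=> x; exact: cvg_cst.
have : \int[@lebesgue_measure R]_(x in `[lo, hi]) (k1 x + cst (k2 c - k1 c) x) <=
       \int[@lebesgue_measure R]_(x in `[lo, hi]) k2 x.
  apply: le_Rintegral => //.
  - exact: within_continuous_integrable (within_continuousD c1 ccst).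
  - exact: within_continuous_integrable.
  - by move=> x xI; have := cmin x xI; rewrite !fctE/=; lra.
rewrite RintegralD//; [|exact: within_continuous_integrable|
  exact: within_continuous_integrable].
have M : @lebesgue_measure R `[lo, hi]%classic = (hi - lo)%:E.
  by rewrite lebesgue_measure_itv/= lte_fin lohi.
rewrite Rintegral_cst// [X in _ * fine X]M/= => H.
by apply: lt_le_trans H; rewrite ltrDl mulr_gt0// subr_gt0.
Qed.

Lemma EFin_Rintegral_itv (R : realType) (lo hi : R) (k : R -> R) :
  {within `[lo, hi], continuous k} ->
  (\int[@lebesgue_measure R]_(x in `[lo, hi]) (k x)%:E)%E =
  (\int[@lebesgue_measure R]_(x in `[lo, hi]) k x)%:E.
Proof.
move=> ck; rewrite /Rintegral fineK//.
exact: integrable_fin_num (within_continuous_integrable ck).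
Qed.

Lemma within_continuous_convex_comp (R : realType) (phi g : R -> R) (lo hi : R) :
  convex_function (setT : set R^o) phi -> {homo phi : x y / x <= y} ->
  {within `[lo, hi], continuous g} ->
  {within `[lo, hi], continuous (fun x => phi (g x))}.
Proof.
move=> cphi mphi cg; change {within `[lo, hi], continuous (phi \o g)}.
apply: within_continuous_comp => // x _.
exact: convex_nondecreasing_continuous.
Qed.

(** * Comparison of the convex integrals for positive b *)

Section convex_comparison.
Context (R : realType) (alpha b : R) (f u du v dv phi : R -> R).
Hypotheses (alpha0 : 0 < alpha) (b0 : 0 < b) (bpi : b < pi)
  (f0 : \forall x \ae (@lebesgue_measure R), x \in `]- pi, pi[ -> 0 <= f x)
  (Su : strong_solution (- pi) pi f u du)
  (Sv : strong_solution (- pi) pi (polarization b f) v dv)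
  (ul : du (- pi) = alpha * u (- pi)) (ur : du pi = - (alpha * u pi))
  (vl : dv (- pi) = alpha * v (- pi)) (vr : dv pi = - (alpha * v pi))
  (cphi : convex_function (setT : set R^o) phi).

Let I g := \int[@lebesgue_measure R]_(x in `[- pi, pi]) phi (g x).

Let bounds : [/\ 0 < b, b < pi & 0 < pi :> R].
Proof. by split => //; exact: pi_gt0. Qed.

Let cont (g : R -> R) lo hi : {homo phi : x y / x <= y} ->
  {within `[- pi, pi], continuous g} -> - pi <= lo -> hi <= pi ->
  {within `[lo, hi], continuous (fun x => phi (g x))}.
Proof.
move=> mphi cg llo hhi; apply: within_continuous_convex_comp => //.
by apply: continuous_subspaceW cg => x /=; rewrite !in_itv/=; lra.
Qed.

(** Weak majorization is applied pointwise, with [s = v x] and [t = v (2 * b - x)]. *)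
Let fold_le : {homo phi : x y / x <= y} ->
  \int[@lebesgue_measure R]_(x in `[2 * b - pi, b])
    (phi (u x) + phi (u (2 * b - x))) <=
  \int[@lebesgue_measure R]_(x in `[2 * b - pi, b])
    (phi (v x) + phi (v (2 * b - x))).
Proof.
move=> mphi; have [b_gt0 b_ltpi pi_gt0] := bounds.
have int (g : R -> R) : {within `[- pi, pi], continuous g} ->
    (@lebesgue_measure R).-integrable `[2 * b - pi, b]
      (EFin \o (fun x => phi (g x) + phi (g (2 * b - x)))).
  move=> cg; apply: within_continuous_integrable; apply: within_continuousD.
    by apply: cont => //; lra.
  have := @within_continuous_reflection R b pi (2 * b) (fun x => phi (g x)).
  have -> : 2 * b - b = b by ring.
  by apply; apply: cont => //; lra.
apply: le_Rintegral => //; [by apply: int; case: Su|by apply: int; case: Sv|].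
move=> x xI; apply: convex_weak_majorization => //.
- apply: (polarization_left_le alpha0 b0 bpi Su Sv ul ur vl vr).
  by move: xI; rewrite /= !in_itv/=; lra.
- exact: (polarization_max_le alpha0 b0 bpi f0 Su Sv ul ur vl vr).
- exact: (polarization_sum_le alpha0 b0 bpi Su Sv ul ur vl vr).
Qed.

Let fold g : {homo phi : x y / x <= y} -> {within `[- pi, pi], continuous g} ->
  I g = \int[@lebesgue_measure R]_(x in `[- pi, 2 * b - pi]) phi (g x) +
    \int[@lebesgue_measure R]_(x in `[2 * b - pi, b]) (phi (g x) + phi (g (2 * b - x))).
Proof.
move=> mphi cg; have [b_gt0 b_ltpi pi_gt0] := bounds.
by apply: (@Rintegral_fold _ _ _ _ (fun x => phi (g x))); [lra|lra|exact: cont].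
Qed.

Let Rintegral_convex_le : {homo phi : x y / x <= y} -> I u <= I v.
Proof.
move=> mphi; have [b_gt0 b_ltpi pi_gt0] := bounds.
have [cu _ _ _] := Su; have [cv _ _ _] := Sv.
rewrite !fold// lerD// ?fold_le//; apply: le_Rintegral => //.
- by apply: within_continuous_integrable; apply: cont => //; lra.
- by apply: within_continuous_integrable; apply: cont => //; lra.
- move=> x xI; apply: mphi.
  apply: (polarization_left_le alpha0 b0 bpi Su Sv ul ur vl vr).
  by move: xI; rewrite /= !in_itv/=; lra.
Qed.

Let Rintegral_convex_eq : {homo phi : x y / x < y} ->
  I u = I v <-> u (- pi) = v (- pi).
Proof.
move=> smphi; have mphi := ltW_homo smphi.
have [b_gt0 b_ltpi pi_gt0] := bounds.
have [cu _ _ _] := Su; have [cv _ _ _] := Sv.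
split=> [Iuv|uv]; last first.
  apply: eq_Rintegral => x /set_mem xI.
  by rewrite (eq_left_end_eq alpha0 b0 bpi Su Sv ul ur vl vr uv).
apply/eqP/negPn/negP => uv.
have : I u < I v.
  (* The strict gain comes from [[- pi, 2 * b - pi]], of length [2 * b > 0]; the folded part
     contributes a weak inequality. *)
  rewrite !fold//; apply: ltr_leD; last exact: fold_le.
  apply: Rintegral_lt; [lra|by apply: cont => //; lra|by apply: cont => //; lra|].
  move=> x xI; apply: smphi.
  exact: (polarization_left_lt alpha0 b0 bpi Su Sv ul ur vl vr uv).
by rewrite Iuv ltxx.
Qed.

Lemma polarization_convex_comparison :
  ({homo phi : x y / x <= y} ->
    (\int[@lebesgue_measure R]_(x in `[(- pi)%R, pi%R]%classic) (phi (u x))%:E <=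
     \int[@lebesgue_measure R]_(x in `[(- pi)%R, pi%R]%classic) (phi (v x))%:E)%E) /\
  ({homo phi : x y / x < y} ->
    ((\int[@lebesgue_measure R]_(x in `[(- pi)%R, pi%R]%classic) (phi (u x))%:E =
      \int[@lebesgue_measure R]_(x in `[(- pi)%R, pi%R]%classic) (phi (v x))%:E)%E <->
     f = polarization b f %[ae (@lebesgue_measure R) in `[- pi, pi]%classic])).
Proof.
have [cu _ _ _] := Su; have [cv _ _ _] := Sv.
split=> mphi.
  by rewrite !EFin_Rintegral_itv ?lee_fin; [exact: Rintegral_convex_le|exact: cont..].
have mphi' := ltW_homo mphi.
rewrite !EFin_Rintegral_itv; [|exact: cont..].
have E := eq_left_end_polarization alpha0 b0 bpi Su Sv ul ur vl vr.
by split=> [[]/(Rintegral_convex_eq mphi)/E|/E/(Rintegral_convex_eq mphi)H]; [|rewrite -!/(I _) H].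
Qed.

End convex_comparison.

(** * Reflection at the origin and the case of negative b *)

(** Reflection at 0 exchanges the two branches of the definition. It is written [0 - x] to match the
    reflection lemmas with [c = 0]. *)
Lemma polarization_opp (R : realType) (b x : R) (f : R -> R) : - pi < b -> b < 0 ->
  polarization (- b) (fun y => f (0 - y)) x = polarization b f (0 - x).
Proof.
move=> bpi b0; rewrite /polarization oppr_gt0 b0 (lt_gtF b0).
have -> : 0 - (2 * - b - x) = 2 * b - (0 - x) by ring.
have -> : (x < 2 * - b - pi) = ~~ (0 - x <= 2 * b + pi).
  by rewrite -ltNge; apply/idP/idP; lra.
have [xb|bx] := leP (0 - x) b.
  have -> /= : (0 - x <= 2 * b + pi) by lra.
  (* Only [x = - b] remains, where one side takes a maximum and the other a minimum of two equal
     values. *)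
  have [xb'|//] := leP x (- b).
  have -> : 2 * b - (0 - x) = 0 - x by lra.
  by rewrite maxxx minxx.
have -> : x <= - b by lra.
by case: (0 - x <= _).
Qed.

Theorem theorem1p1 (R : realType) (alpha : R) (f : R -> R) (b : R)
    (u v : R -> R) :
  0 < alpha ->
  (@lebesgue_measure R).-integrable `[- pi, pi]%classic (EFin \o f) ->
  (\forall x \ae (@lebesgue_measure R), x \in `[- pi, pi] -> 0 <= f x) ->
  (b \in `]- pi, 0[) \/ (b \in `]0, pi[) ->
  robin_solution alpha f u ->
  robin_solution alpha (polarization b f) v ->
  forall phi : R -> R, convex_function (setT : set R^o) phi ->
    ({homo phi : x y / x <= y} ->
      (\int[@lebesgue_measure R]_(x in `[(- pi)%R, pi%R]%classic) (phi (u x))%:E <=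
       \int[@lebesgue_measure R]_(x in `[(- pi)%R, pi%R]%classic) (phi (v x))%:E)%E) /\
    ({homo phi : x y / x < y} ->
      ((\int[@lebesgue_measure R]_(x in `[(- pi)%R, pi%R]%classic) (phi (u x))%:E =
        \int[@lebesgue_measure R]_(x in `[(- pi)%R, pi%R]%classic) (phi (v x))%:E)%E <->
       f = polarization b f %[ae (@lebesgue_measure R) in `[- pi, pi]%classic])).
Proof.
move=> alpha0 _ f0 bI /robin_solution_strong[du [Su ul ur]].
move=> /robin_solution_strong[dv [Sv vl vr]] phi cphi.
have f0' : \forall x \ae (@lebesgue_measure R), x \in `]- pi, pi[ -> 0 <= f x.
  apply: filterS f0 => x H xI; apply: H.
  by move: xI; rewrite !in_itv/= => /andP[/ltW-> /ltW->].
have [b0|b_le0] := ltP 0 b.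
  have bpi : b < pi.
    by case: bI; rewrite in_itv/= => /andP[? ?] //; exact: lt_trans (pi_gt0 R).
  exact: (polarization_convex_comparison alpha0 b0 bpi f0' Su Sv).
have [bpi b0] : - pi < b /\ b < 0.
  by case: bI; rewrite in_itv/= => /andP[? ?] //; exfalso; lra.
have E1 : 0 - pi = - pi :> R by rewrite sub0r.
have E2 : 0 - - pi = pi :> R by rewrite sub0r opprK.
have pE : (fun x => polarization b f (0 - x)) =
    polarization (- b) (fun y => f (0 - y)).
  by apply/funext => x; rewrite polarization_opp.
have Su' := strong_solution_reflection 0 Su; rewrite E1 E2 in Su'.
have Sv' := strong_solution_reflection 0 Sv; rewrite E1 E2 pE in Sv'.
have nb0 : 0 < - b by rewrite oppr_gt0.
have nbpi : - b < pi by rewrite ltrNl.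
have f0N : \forall x \ae (@lebesgue_measure R), x \in `]- pi, pi[ -> 0 <= f (0 - x).
  apply: filterS (ae_reflection 0 f0') => x H xI; apply: H.
  by move: xI; rewrite !in_itv/=; lra.
(* The four remaining conditions are the Robin conditions of [u] and [v] with the two ends
   exchanged. *)
have [] := @polarization_convex_comparison R alpha (- b) _ _ _ _ _ phi alpha0 nb0
  nbpi f0N Su' Sv' _ _ _ _ cphi; [by rewrite E2 ur opprK|by rewrite E1 ul|
  by rewrite E2 vr opprK|by rewrite E1 vl|].
have intE (g : R -> R) : {within `[- pi, pi], continuous g} ->
    {homo phi : x y / x <= y} ->
    (\int[@lebesgue_measure R]_(x in `[(- pi)%R, pi%R]) (phi (g (0 - x)%R))%:E =
     \int[@lebesgue_measure R]_(x in `[(- pi)%R, pi%R]) (phi (g x))%:E)%E.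
  move=> cg mphi; have cpg := within_continuous_convex_comp cphi mphi cg.
  have := @within_continuous_reflection _ _ _ 0 _ cpg; rewrite E1 E2 => cpg'.
  rewrite !EFin_Rintegral_itv//; congr EFin.
  have := @Rintegral_reflection R (- pi) pi 0 (fun x => phi (g x)).
  by rewrite E1 E2 => -> //; have := pi_gt0 R; lra.
have [cu _ _ _] := Su; have [cv _ _ _] := Sv.
(* Reflection preserves null sets and the interval, so the equality condition for [- b] translates
   back to [b]. *)
have aeE : (\forall x \ae (@lebesgue_measure R), x \in `[- pi, pi] ->
      f (0 - x) = polarization (- b) (fun y => f (0 - y)) x) <->
    (\forall x \ae (@lebesgue_measure R), x \in `[- pi, pi] -> f x = polarization b f x).
  have xI (x : R) : x \in `[- pi, pi] -> 0 - x \in `[- pi, pi].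
    by rewrite !in_itv/=; lra.
  split=> H; apply: filterS (ae_reflection 0 H) => x + /xI xI' => /(_ xI').
    by rewrite polarization_opp// !sub0r opprK.
  by rewrite polarization_opp.
move=> H1 H2; split=> mphi.
  by rewrite -(intE u)// -(intE v)//; exact: H1.
have mphi' := ltW_homo mphi.
by rewrite -(intE u)// -(intE v)//; apply: iff_trans (H2 mphi) aeE.
Qed.
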